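(* Let $n \in \mathbb{N}_0$, let $T$ be an $n$-dimensional simplex with ordered vertices, let $k \in [0:n]$ and let $r \geq 1$ be an integer. Then the set $$\mathcal{B}\mathcal{P}_r\Lambda^{k}(T) := \left\{ \lambda^{\alpha}\, \mathrm{d}\lambda_{\sigma} \;\middle|\; \alpha \in A(r,n),\ \sigma \in \Sigma(k,n),\ \lfloor\alpha\rfloor \notin [\sigma] \right\}$$ is a basis of the space $$\mathcal{P}_r\Lambda^{k}(T) := \operatorname{span}\left\{ \lambda^{\alpha}\, \mathrm{d}\lambda_{\sigma} \;\middle|\; \alpha \in A(r,n),\ \sigma \in \Sigma(k,n) \right\}.$$
   Context: All vector spaces are over $\mathbb{C}$. For integers $a,b$, $[a:b]=\{a,\dots,b\}$ (empty if $a>b$). An $n$-dimensional simplex $T$ is the convex hull of $n+1$ affinely independent points $v_0,\dots,v_n$ (its ordered vertices) in some Euclidean space. $\Lambda^k(T)$ is the space of (complex-valued) smooth differential $k$-forms on $T$ all of whose coefficients have bounded derivatives of all orders. The barycentric coordinates $\lambda_0,\dots,\lambda_n$ are the affine functions on $T$ with $\lambda_i(v_j)=\delta_{ij}$, and $\mathrm{d}\lambda_i \in \Lambda^1(T)$ are their exterior derivatives. $A(r,n)$ is the set of maps $\alpha:[0:n]\to\mathbb{N}_0$ with $|\alpha|:=\sum_{i=0}^n\alpha(i)=r$; $[\alpha]=\{i\in[0:n] : \alpha(i)>0\}$; $\lfloor\alpha\rfloor$ is the minimal element of $[\alpha]$ (and $\infty$ if $[\alpha]=\emptyset$); $\lambda^\alpha=\prod_{i=0}^n\lambda_i^{\alpha(i)}$.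 $\Sigma(k,n)$ is the set of strictly increasing maps $\sigma:[1:k]\to[0:n]$ (with $\Sigma(0,n)=\{\emptyset\}$); $[\sigma]$ is the image of $\sigma$; $\mathrm{d}\lambda_\sigma=\mathrm{d}\lambda_{\sigma(1)}\wedge\dots\wedge \mathrm{d}\lambda_{\sigma(k)}$, with $\mathrm{d}\lambda_\emptyset=1$. *)

(* Defs.v *)
From HB Require Import structures.
From mathcomp Require Import all_boot all_order all_fingroup all_algebra.
From mathcomp Require Import complex.
From mathcomp Require Import all_classical all_reals all_analysis.

Set Implicit Arguments.
Unset Strict Implicit.
Unset Printing Implicit Defensive.

Import Order.TTheory GRing.Theory Num.Theory.
Import numFieldNormedType.Exports.

Local Open Scope classical_set_scope.
Local Open Scope ring_scope.
Local Open Scope complex_scope.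

Section LinearAlgebra.
Variables (K : fieldType) (E : lmodType K).
Implicit Types B W : set E.

Definition lin_span B : set E :=
  [set w | exists (s : seq E) (c : E -> K),
     (forall b, b \in s -> B b) /\ w = \sum_(b <- s) c b *: b].

Definition lin_indep B : Prop :=
  forall (s : seq E) (c : E -> K), uniq s -> (forall b, b \in s -> B b) ->
    \sum_(b <- s) c b *: b = 0 -> forall b, b \in s -> c b = 0.

Definition is_basis B W : Prop := lin_indep B /\ lin_span B = W.

End LinearAlgebra.

Definition affinely_independent (R : realType) (m n : nat)
    (v : 'I_n.+1 -> 'rV[R]_m) : Prop :=
  forall c : 'I_n.+1 -> R,
    \sum_j c j = 0 -> \sum_j c j *: v j = 0 -> forall j, c j = 0.

Record simplex (R : realType) (m n : nat) := Simplex {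
  vertex :> 'I_n.+1 -> 'rV[R]_m;
  vertex_indep : affinely_independent vertex }.

Section Simplex.
Variables (R : realType) (m n : nat) (T : simplex R m n).
Local Notation V := 'rV[R]_m.

Definition spx : set V :=
  [set x | exists t : 'I_n.+1 -> R,
     [/\ forall j, 0 <= t j, \sum_j t j = 1 & x = \sum_j t j *: T j]].

Definition spx_aff : set V :=
  [set x | exists t : 'I_n.+1 -> R,
     \sum_j t j = 1 /\ x = \sum_j t j *: T j].

(* relative interior *)
Definition spx_int : set V :=
  [set x | exists t : 'I_n.+1 -> R,
     [/\ forall j, 0 < t j, \sum_j t j = 1 & x = \sum_j t j *: T j]].

(* tangent space of T, the direction of its affine hull *)
Definition tangent : {vspace V} := <<[seq T j - T ord0 | j : 'I_n.+1]>>%VS.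
Local Notation TV := (subvs_of tangent).

Lemma spx_int_sub : spx_int `<=` spx.
Proof. by move=> x [t [t0 t1 ->]]; exists t; split=> // j; exact: ltW. Qed.

Lemma spx_sub_aff : spx `<=` spx_aff.
Proof. by move=> x [t [t0 t1 ->]]; exists t. Qed.

Lemma coords_inj (s t : 'I_n.+1 -> R) : \sum_j s j = \sum_j t j ->
  \sum_j s j *: T j = \sum_j t j *: T j -> s =1 t.
Proof.
move=> st sTt j; apply/eqP; rewrite -subr_eq0; apply/eqP.
apply: (@vertex_indep _ _ _ T (fun j => s j - t j)).
  by rewrite sumrB st subrr.
rewrite (eq_bigr (fun j => s j *: T j - t j *: T j)) => [|i _].
  by rewrite sumrB sTt subrr.
by rewrite scalerBl.
Qed.

(* The i-th barycentric coordinate, as an affine function on the affine hull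
   of T (outside of which its value is irrelevant). *)
Definition bary (i : 'I_n.+1) (x : V) : R :=
  xget (fun=> 0) [set t : 'I_n.+1 -> R |
    \sum_j t j = 1 /\ x = \sum_j t j *: T j] i.

Lemma baryE (t : 'I_n.+1 -> R) i : \sum_j t j = 1 ->
  bary i (\sum_j t j *: T j) = t i.
Proof.
move=> t1; rewrite /bary; case: xgetP => [s _ [s1 sE]|/(_ t)[]//].
by apply: coords_inj; [rewrite s1 t1|rewrite -sE].
Qed.

Lemma bary_vertex i j : bary i (T j) = (i == j)%:R.
Proof.
have <- : \sum_l (l == j)%:R *: T l = T j.
  rewrite (bigD1 j)//= eqxx scale1r big1 ?addr0// => l /negPf->.
  by rewrite scale0r.
rewrite baryE// (bigD1 j)//= eqxx big1 ?addr0// => l /negPf->//.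
Qed.

Lemma bary_affine i x y (a : R) : spx_aff x -> spx_aff y ->
  bary i (a *: x + (1 - a) *: y) = a * bary i x + (1 - a) * bary i y.
Proof.
move=> [t [t1 ->]] [s [s1 ->]]; rewrite !baryE//.
rewrite !scaler_sumr -big_split/=.
under eq_bigr do rewrite !scalerA -scalerDl.
by rewrite baryE// big_split/= -!mulr_sumr t1 s1 !mulr1 addrC subrK.
Qed.

Lemma tangentP (u : TV) : exists c : 'I_n.+1 -> R,
  \sum_j c j = 0 /\ vsval u = \sum_j c j *: T j.
Proof.
pose X := in_tuple [seq T j - T ord0 | j : 'I_n.+1].
have uE : vsval u = \sum_i coord X i (vsval u) *: X`_i.
  by apply: coord_span; exact: subvsP.
have: forall i : 'I_(size X), exists c : 'I_n.+1 -> R,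
    \sum_j c j = 0 /\ X`_i = \sum_j c j *: T j.
  move=> i; have /mapP[l _ ->] := mem_nth 0 (ltn_ord i).
  exists (fun j => (j == l)%:R - (j == ord0)%:R); split=> /=.
    rewrite sumrB (bigD1 l)//= eqxx big1 ?addr0 => [|j /negPf->//].
    by rewrite (bigD1 ord0)//= ?eqxx big1 ?addr0 ?subrr => [//|j /negPf->//].
  rewrite (eq_bigr (fun j => (j == l)%:R *: T j - (j == ord0)%:R *: T j)).
    rewrite sumrB (bigD1 l)//= eqxx big1 ?addr0 => [|j /negPf->].
      rewrite (bigD1 ord0)//= ?eqxx big1 ?addr0 ?scale1r => [//|j /negPf->].
      by rewrite scale0r.
    by rewrite scale0r.
  by move=> j _; rewrite scalerBl.
move=> /choice[c cP].
exists (fun j => \sum_i coord X i (vsval u) * c i j); split=> /=.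
  rewrite exchange_big/= big1// => i _.
  by rewrite -mulr_sumr (cP i).1 mulr0.
under eq_bigr do rewrite scaler_suml.
rewrite {1}uE exchange_big/=; apply: eq_bigr => i _.
rewrite (cP i).2 scaler_sumr; apply: eq_bigr => j _.
by rewrite scalerA.
Qed.

(* the linear part of the i-th barycentric coordinate *)
Definition bary_lin (i : 'I_n.+1) (u : V) : R :=
  xget (fun=> 0) [set c : 'I_n.+1 -> R |
    \sum_j c j = 0 /\ u = \sum_j c j *: T j] i.

Lemma bary_linE (c : 'I_n.+1 -> R) i : \sum_j c j = 0 ->
  bary_lin i (\sum_j c j *: T j) = c i.
Proof.
move=> c0; rewrite /bary_lin; case: xgetP => [s _ [s0 sE]|/(_ c)[]//].
by apply: coords_inj; [rewrite s0 c0|rewrite -sE].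
Qed.

Lemma bary_lin_linear i (a : R) (u w : TV) :
  bary_lin i (vsval (a *: u + w)) =
  a * bary_lin i (vsval u) + bary_lin i (vsval w).
Proof.
rewrite linearP/=.
have [c [c0 ->]] := tangentP u; have [d [d0 ->]] := tangentP w.
rewrite !bary_linE// scaler_sumr -big_split/=.
rewrite (eq_bigr (fun j => (a * c j + d j) *: T j)) => [|j _].
  by rewrite bary_linE// big_split/= -mulr_sumr c0 d0 mulr0 addr0.
by rewrite scalerDl scalerA.
Qed.

Lemma bary_shift i x (u : TV) (h : R) : spx_aff x ->
  bary i (h *: vsval u + x) = h * bary_lin i (vsval u) + bary i x.
Proof.
move=> [t [t1 ->]]; have [c [c0 ->]] := tangentP u.
rewrite bary_linE// baryE// scaler_sumr -big_split/=.
rewrite (eq_bigr (fun j => (h * c j + t j) *: T j)) => [|j _].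
  by rewrite baryE// big_split/= -mulr_sumr c0 t1 mulr0 add0r.
by rewrite scalerDl scalerA.
Qed.

Lemma spx_int_shift x (u : TV) : spx_int x ->
  \forall h \near (0 : R), spx_int (h *: vsval u + x).
Proof.
move=> [t [t0 t1 ->]]; have [c [c0 ->]] := tangentP u.
have ct : \forall h \near (0 : R), forall j, 0 < h * c j + t j.
  apply: (@filter_forall R _ (fun j h => 0 < h * c j + t j) (nbhs (0 : R)) _) => j.
  have : (fun h => h * c j + t j) @ (0 : R) --> (0 * c j + t j : R).
    by apply: cvgD; [apply: cvgMl; exact: cvg_id|exact: cvg_cst].
  by rewrite mul0r add0r => /cvgr_gt; apply.
near=> h; exists (fun j => h * c j + t j); split=> /=.
- by near: h.
- by rewrite big_split/= -mulr_sumr c0 t1 mulr0 add0r.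
- rewrite scaler_sumr -big_split/=; apply: eq_bigr => j _.
  by rewrite scalerDl scalerA.
Unshelve. all: by end_near. Qed.

Lemma is_derive_bary i x (u : TV) : spx_aff x ->
  is_derive x (vsval u) (bary i) (bary_lin i (vsval u)).
Proof.
move=> Tx.
have H : (fun h : R => h^-1 *: ((bary i \o shift x) (h *: vsval u) - bary i x))
    @ 0^' --> bary_lin i (vsval u).
  apply: cvg_trans (cvg_cst (bary_lin i (vsval u)) (F := (0:R)^')).
  apply: near_eq_cvg; near=> h.
  have h0 : h != 0 by near: h; exact: nbhs_dnbhs_neq.
  by rewrite /= bary_shift// addrK /GRing.scale/= mulrA mulVf// mul1r.
by apply: DeriveDef; [apply/cvg_ex; eexists; exact: H|exact/cvg_lim].
Unshelve. all: by end_near. Qed.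

Lemma derivable_congr (f g : V -> R) x (u : TV) :
  (forall y, spx_int y -> f y = g y) -> spx_int x ->
  (fun h : R => h^-1 *: ((f \o shift x) (h *: vsval u) - f x)) @ 0^' =
  (fun h : R => h^-1 *: ((g \o shift x) (h *: vsval u) - g x)) @ 0^'.
Proof.
move=> fg Tx.
have near_fg : \forall h \near (0 : R)^',
    h^-1 *: ((f \o shift x) (h *: vsval u) - f x) =
    h^-1 *: ((g \o shift x) (h *: vsval u) - g x).
  have := spx_int_shift u Tx => /nbhs_dnbhs; apply: filterS => h Th /=.
  by rewrite !fg.
apply/seteqP; split; apply: near_eq_cvg => //.
by apply: filterS near_fg => h ->.
Qed.

Fixpoint bounded_derivs (p : nat) (f : V -> R) : Prop :=
  (exists M, forall x, spx_int x -> `|f x| <= M) /\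
  if p is q.+1 then
    forall u : TV, (forall x, spx_int x -> derivable f x (vsval u)) /\
                   bounded_derivs q ('D_(vsval u) f)
  else True.

(* Smooth real functions on T with bounded derivatives of all orders: in the
   relative interior of T all iterated derivatives along tangent vectors exist
   and are bounded.  At such points these derivatives depend only on the values
   of f on T.  Continuity on T determines f on the boundary. *)
Definition smooth (f : V -> R) : Prop :=
  {within spx, continuous f} /\ forall p, bounded_derivs p f.

Lemma bounded_derivs_congr p (f g : V -> R) :
  (forall y, spx_int y -> f y = g y) ->
  bounded_derivs p f -> bounded_derivs p g.
Proof.
elim: p f g => [|p IH] f g fg [[M fM] df]; (split; first by
  exists M => x Tx; rewrite -fg//; exact: fM) => //.
move=> u; have [fu fp] := df u; split=> [x Tx|].
  have := fu x Tx; rewrite /derivable (derivable_congr _ fg)//.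
by apply: IH fp => y Ty; rewrite /derive (derivable_congr _ fg).
Qed.

Lemma bounded_derivsW p (f : V -> R) :
  bounded_derivs p.+1 f -> bounded_derivs p f.
Proof.
elim: p f => [|p IH] f [fM df]; split=> // u.
by have [? ?] := df u; split=> //; exact: IH.
Qed.

Lemma bounded_derivs_bd p (f : V -> R) : bounded_derivs p f ->
  exists M, forall x, spx_int x -> `|f x| <= M.
Proof. by case: p => [|p] []. Qed.

Lemma bounded_derivsD p (f g : V -> R) : bounded_derivs p f ->
  bounded_derivs p g -> bounded_derivs p (fun x => f x + g x).
Proof.
elim: p f g => [|p IH] f g fp gp.
all: have [[M fM] df] := fp; have [[N gN] dg] := gp.
all: split=> //; first (exists (M + N) => x Tx;
  by rewrite (le_trans (ler_normD _ _))// lerD ?fM ?gN).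
move=> u; have [fu fpu] := df u; have [gu gpu] := dg u; split=> [x Tx|].
  by apply: derivableD; [exact: fu|exact: gu].
apply: bounded_derivs_congr (IH _ _ fpu gpu) => x Tx.
by rewrite -deriveD//; [exact: fu|exact: gu].
Qed.

Lemma bounded_derivsM p (f g : V -> R) : bounded_derivs p f ->
  bounded_derivs p g -> bounded_derivs p (fun x => f x * g x).
Proof.
elim: p f g => [|p IH] f g fp gp.
all: have [[M fM] df] := fp; have [[N gN] dg] := gp.
all: split=> //; first (exists (M * N) => x Tx;
  by rewrite normrM ler_pM ?fM ?gN).
move=> u; have [fu fpu] := df u; have [gu gpu] := dg u; split=> [x Tx|].
  by apply: derivableM; [exact: fu|exact: gu].
have H := bounded_derivsD (IH _ _ (bounded_derivsW fp) gpu)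
                          (IH _ _ (bounded_derivsW gp) fpu).
apply: bounded_derivs_congr H => x Tx.
by rewrite [RHS](@deriveM _ _ f g)//; [exact: fu|exact: gu].
Qed.

Lemma bounded_derivs_cst p (a : R) : bounded_derivs p (cst a).
Proof.
elim: p a => [|p IH] a; (split; first by exists `|a|) => //.
move=> u; split=> [x _|]; first exact: derivable_cst.
by apply: bounded_derivs_congr (IH 0) => x _; rewrite derive_cst.
Qed.

Lemma bounded_derivs_bary p i : bounded_derivs p (bary i).
Proof.
have bd : exists M, forall x, spx_int x -> `|bary i x| <= M.
  exists 1 => x [t [t0 t1 ->]]; rewrite baryE// gtr0_norm// -t1.
  by rewrite (bigD1 i)//= lerDl sumr_ge0// => j _; exact: ltW.
case: p => [|p]; split=> // u.
have D x : spx_int x -> is_derive x (vsval u) (bary i) (bary_lin i (vsval u)).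
  by move=> /spx_int_sub/spx_sub_aff; exact: is_derive_bary.
split=> [x /D[]//|].
apply: bounded_derivs_congr (bounded_derivs_cst p (bary_lin i (vsval u))).
by move=> x Tx; have [_ ->] := D x Tx.
Qed.

Lemma continuous_spx_bary i : {within spx, continuous (bary i)}.
Proof.
pose A : 'M[R]_(n.+1, m + 1) := \matrix_j row_mx (T j) 1.
have sumA (c : 'I_n.+1 -> R) :
    (\row_j c j) *m A = row_mx (\sum_j c j *: T j) (\sum_j c j)%:M.
  rewrite mulmx_sum_row (eq_bigr (fun j => row_mx (c j *: T j) (c j)%:M)).
    elim/big_rec3 : _ => [|j x y z _ ->]; first by rewrite raddf0 row_mx0.
    by rewrite add_row_mx raddfD.
  by move=> j _; rewrite mxE rowK scale_row_mx scalemx1.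
have A_free : row_free A.
  rewrite -kermx_eq0; apply/rowV0P => c /sub_kermxP.
  rewrite (_ : c = \row_j c 0 j); last by apply/rowP => j; rewrite mxE.
  rewrite sumA -row_mx0 => /eq_row_mx[cT c0].
  have {}c0 : \sum_j c 0 j = 0.
    by move: c0 => /matrixP/(_ 0 0); rewrite !mxE.
  by apply/rowP => j; rewrite !mxE; exact: vertex_indep c0 cT j.
have bE x : spx x -> (row_mx x 1 *m pinvmx A) 0 i = bary i x.
  move=> [t [_ t1 ->]]; rewrite baryE//.
  have := sumA t; rewrite t1 => <-.
  by rewrite mulmxKp// mxE.
apply: (@subspace_eq_continuous _ spx _ (fun x => (row_mx x 1 *m pinvmx A) 0 i)).
  by move=> x; rewrite inE; exact: bE.
apply: continuous_subspaceT.
rewrite (_ : (fun y => _) = (fun y : V => \sum_j y 0 j * usubmx (pinvmx A) j i)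
   + cst ((1 *m dsubmx (pinvmx A)) 0 i)); last first.
  apply/funext => y; rewrite -[X in _ *m X](vsubmxK (pinvmx A)) mul_row_col.
  by rewrite !mxE.
move=> x; apply: continuousD; last exact: cst_continuous.
apply: continuous_big => [|j _]; first exact: add_continuous.
move=> y; apply: continuousM; last exact: cst_continuous.
exact: coord_continuous.
Qed.

Lemma smooth_congr (f g : V -> R) :
  (forall x, spx x -> f x = g x) -> smooth f -> smooth g.
Proof.
move=> fg [fc fs]; split=> [|p].
  by apply: subspace_eq_continuous fc => x; rewrite inE; exact: fg.
by apply: bounded_derivs_congr (fs p) => y /spx_int_sub; exact: fg.
Qed.

Lemma smooth_cst (a : R) : smooth (fun=> a).
Proof.
split=> [|p]; last exact: bounded_derivs_cst.
by apply: continuous_subspaceT; exact: cst_continuous.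
Qed.

Lemma smoothD (f g : V -> R) :
  smooth f -> smooth g -> smooth (fun x => f x + g x).
Proof.
move=> [fc fs] [gc gs]; split=> [|p]; last exact: bounded_derivsD.
by move=> x; apply: cvgD; [exact: fc|exact: gc].
Qed.

Lemma smoothM (f g : V -> R) :
  smooth f -> smooth g -> smooth (fun x => f x * g x).
Proof.
move=> [fc fs] [gc gs]; split=> [|p]; last exact: bounded_derivsM.
by move=> x; apply: cvgM; [exact: fc|exact: gc].
Qed.

Lemma smooth_bary i : smooth (bary i).
Proof.
split=> [|p]; [exact: continuous_spx_bary|exact: bounded_derivs_bary].
Qed.

Definition csmooth (f : V -> R[i]) : Prop :=
  smooth (fun x => complex.Re (f x)) /\ smooth (fun x => complex.Im (f x)).

Lemma csmooth_congr (f g : V -> R[i]) :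
  (forall x, spx x -> f x = g x) -> csmooth f -> csmooth g.
Proof.
by move=> fg [fr fi]; split; [move: fr|move: fi]; apply: smooth_congr => x /fg->.
Qed.

Lemma csmooth_cst (a : R[i]) : csmooth (fun=> a).
Proof. by split; exact: smooth_cst. Qed.

Lemma csmooth_real (f : V -> R) : smooth f -> csmooth (fun x => (f x)%:C).
Proof. by move=> fs; split=> //; exact: smooth_cst. Qed.

Lemma csmoothD (f g : V -> R[i]) :
  csmooth f -> csmooth g -> csmooth (fun x => f x + g x).
Proof.
move=> [fr fi] [gr gi]; split.
- by apply: smooth_congr (smoothD fr gr) => x _; case: (f x); case: (g x).
- by apply: smooth_congr (smoothD fi gi) => x _; case: (f x); case: (g x).
Qed.

Lemma csmoothM (f g : V -> R[i]) :
  csmooth f -> csmooth g -> csmooth (fun x => f x * g x).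
Proof.
move=> [fr fi] [gr gi]; split.
- apply: smooth_congr (smoothD (smoothM fr gr)
    (smoothM (smooth_cst (-1)) (smoothM fi gi))) => x _.
  by rewrite mulN1r; case: (f x); case: (g x).
- apply: smooth_congr (smoothD (smoothM fr gi) (smoothM fi gr)) => x _.
  by case: (f x); case: (g x).
Qed.

Lemma csmooth_sum (I : Type) (s : seq I) (f : I -> V -> R[i]) :
  (forall i, csmooth (f i)) -> csmooth (fun x => \sum_(i <- s) f i x).
Proof.
move=> fs; elim: s => [|i s IH].
  by apply: csmooth_congr (csmooth_cst 0) => x _; rewrite big_nil.
apply: csmooth_congr (csmoothD (fs i) IH) => x _.
by rewrite big_cons.
Qed.

Definition update (k : nat) (u : 'I_k -> TV) (i : 'I_k) (w : TV) : 'I_k -> TV :=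
  fun j => if j == i then w else u j.

Definition alternating (k : nat) (f : ('I_k -> TV) -> R[i]) : Prop :=
  (forall i u (a : R) w1 w2,
     f (update u i (a *: w1 + w2)) =
     a%:C * f (update u i w1) + f (update u i w2)) /\
  (forall u i j, i != j -> u i = u j -> f u = 0).

(* Forms are fields of alternating forms on T, extended by 0 outside of T, so
   that two forms are equal exactly when they agree on T.  Their coefficients
   are the functions x |-> w x u with u_1, ..., u_k tangent to T. *)
Definition is_form (k : nat) (w : V -> ('I_k -> TV) -> R[i]^o) : Prop :=
  [/\ forall x, ~ spx x -> forall u, w x u = 0,
      forall x, alternating (w x) &
      forall u, csmooth (fun x => w x u)].

Definition diff_form (k : nat) : {pred V -> ('I_k -> TV) -> R[i]^o} :=
  [pred w : V -> ('I_k -> TV) -> R[i]^o | `[< is_form w >]].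

Lemma diff_form_submod_closed (k : nat) : submod_closed (@diff_form k).
Proof.
split=> [|a w e /asboolP[w0 wa ws] /asboolP[e0 ea es]]; apply/asboolP.
  split=> // [x|u]; last exact: csmooth_cst.
  by split=> // *; rewrite mulr0 addr0.
split=> [x Tx u|x|u].
- by rewrite /= !fctE w0// e0// scaler0 addr0.
- have [wl wz] := wa x; have [el ez] := ea x; split=> [i u b y z|u i j ij uij].
    rewrite !fctE wl el /GRing.scale/= mulrDr mulrDr !addrA; congr (_ + _).
    by rewrite -!addrA; congr (_ + _); [rewrite mulrCA|rewrite addrC].
  by rewrite !fctE (wz _ _ _ ij)// (ez _ _ _ ij)// scaler0 addr0.
- exact: csmoothD (csmoothM (csmooth_cst a) (ws u)) (es u).
Qed.

HB.instance Definition _ (k : nat) := GRing.isSubmodClosed.Build R[i]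
  (V -> ('I_k -> TV) -> R[i]^o) (@diff_form k) (@diff_form_submod_closed k).

Record form (k : nat) := Form {
  form_val :> V -> ('I_k -> TV) -> R[i]^o;
  _ : form_val \in @diff_form k }.

HB.instance Definition _ (k : nat) := [isSub for @form_val k].
HB.instance Definition _ (k : nat) := [Choice of form k by <:].
HB.instance Definition _ (k : nat) := [SubChoice_isSubLmodule of form k by <:].

Lemma formP (k : nat) (w : form k) : is_form w.
Proof. by apply/asboolP; exact: (valP w). Qed.

Lemma one_form_proof : (fun x (_ : 'I_0 -> TV) => (x \in spx)%:R) \in @diff_form 0.
Proof.
apply/asboolP; split=> [x Tx u|x|u].
- by rewrite memNset.
- by split=> [[]|u []].
- by apply: csmooth_congr (csmooth_cst 1) => x Tx; rewrite mem_set.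
Qed.

Definition form_one : form 0 := Form one_form_proof.

(* The exterior derivative of the i-th barycentric coordinate, whose value at x
   on a tangent vector is the derivative of bary i at x along that vector.
   This is the two-sided derivative also at boundary points of T because bary i
   is affine on the whole affine hull. *)
Lemma dbary_proof i :
  (fun x (u : 'I_1 -> TV) =>
     if x \in spx then ('D_(vsval (u ord0)) (bary i) x)%:C else 0)
  \in @diff_form 1.
Proof.
have D x (u : TV) : spx x -> 'D_(vsval u) (bary i) x = bary_lin i (vsval u).
  by move=> /spx_sub_aff Tx; have [_ ->] := is_derive_bary i u Tx.
apply/asboolP; split=> [x Tx u|x|u].
- by rewrite memNset.
- case: (boolP (x \in spx)) => [|_]; last first.
    by split=> // *; rewrite mulr0 addr0.
  rewrite inE => Tx; split=> [j u a y z|u j j']; last by rewrite !ord1.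
  by rewrite !D// /update !ord1 eqxx bary_lin_linear rmorphD rmorphM.
- apply: csmooth_congr (csmooth_cst (bary_lin i (vsval (u ord0)))%:C) => x Tx.
  by rewrite mem_set// D.
Qed.

Definition dbary i : form 1 := Form (dbary_proof i).

(* Wedge product, normalized so that the wedge of covectors f_1, ..., f_k maps
   (u_1, ..., u_k) to det (f_i u_j). *)
Lemma wedge_proof (k l : nat) (w : form k) (e : form l) :
  (fun x (u : 'I_(k + l) -> TV) => (k`! * l`!)%:R^-1 *
     \sum_(s : 'S_(k + l)) (-1) ^+ s *
       (w x (fun i => u (s (lshift l i))) * e x (fun j => u (s (rshift k j)))))
  \in @diff_form (k + l).
Proof.
have [w0 wa ws] := formP w; have [e0 ea es] := formP e.
apply/asboolP; split=> [x Tx u|x|u].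
- by rewrite big1 ?mulr0// => s _; rewrite w0// mul0r mulr0.
- have [wl wz] := wa x; have [el ez] := ea x; split=> [i u b y z|u i j ij uij].
    rewrite [b%:C * _]mulrCA -mulrDr; congr (_ * _).
    rewrite mulr_sumr -big_split/=; apply: eq_bigr => s _.
    rewrite [b%:C * _]mulrCA -mulrDr; congr (_ * _).
    have := splitK ((s^-1)%g i); case: (fintype.split _) => a /= sa; have si := permKV s i; rewrite -sa in si.
      have up t : (fun c => update u i t (s (lshift l c))) =
                  update (fun c => u (s (lshift l c))) a t.
        apply/funext => c; rewrite /update -{1}si.
        by rewrite (inj_eq perm_inj) (inj_eq (@lshift_inj _ _)).
      have ur t : (fun c => update u i t (s (rshift k c))) =
                  (fun c => u (s (rshift k c))).
        apply/funext => c; rewrite /update -{1}si.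
        by rewrite (inj_eq perm_inj) eq_rlshift.
      by rewrite !up !ur wl mulrDl mulrA.
    have up t : (fun c => update u i t (s (rshift k c))) =
                update (fun c => u (s (rshift k c))) a t.
      apply/funext => c; rewrite /update -{1}si.
      by rewrite (inj_eq perm_inj) (inj_eq (@rshift_inj _ _)).
    have ul t : (fun c => update u i t (s (lshift l c))) =
                (fun c => u (s (lshift l c))).
      apply/funext => c; rewrite /update -{1}si.
      by rewrite (inj_eq perm_inj) eq_lrshift.
    by rewrite !up !ul el mulrDr mulrCA.
  set S := \sum_s _.
  suff SN : S = - S.
    have : S *+ 2 == 0 by rewrite mulr2n {1}SN addNr.
    by rewrite mulrn_eq0/= => /eqP->; rewrite mulr0.
  rewrite {1}/S (reindex_inj (mulIg (tperm i j)))/= -sumrN.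
  apply: eq_bigr => s _.
  rewrite odd_permM odd_tperm ij addbT signrN mulNr.
  have ut c : u (tperm i j c) = u c by case: tpermP => [->|->|].
  congr (- (_ * (_ * _))); congr (_ x _); apply/funext => c;
    by rewrite permM ut.
- apply: csmoothM; first exact: csmooth_cst.
  apply: csmooth_sum => s; apply: csmoothM; first exact: csmooth_cst.
  by apply: csmoothM; [exact: ws|exact: es].
Qed.

Definition wedge (k l : nat) (w : form k) (e : form l) : form (k + l) :=
  Form (wedge_proof w e).

(* w_1 /\ ... /\ w_k, which is the constant 1 for k = 0 *)
Fixpoint wedges (k : nat) : ('I_k -> form 1) -> form k :=
  match k with
  | 0 => fun=> form_one
  | k'.+1 => fun w => wedge (w ord0) (wedges (fun i => w (lift ord0 i)))
  end.

Definition bary_pow (a : 'I_n.+1 -> nat) (x : V) : R :=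
  \prod_i bary i x ^+ a i.

Lemma smooth_bary_pow a : smooth (bary_pow a).
Proof.
rewrite /bary_pow; elim: (index_enum _) => [|i s IH].
  by apply: smooth_congr (smooth_cst 1) => x _; rewrite big_nil.
have bi p : smooth (fun x => bary i x ^+ p).
  elim: p => [|p IHp]; first exact: smooth_cst.
  by apply: smooth_congr (smoothM (smooth_bary i) IHp) => x _; rewrite exprS.
by apply: smooth_congr (smoothM (bi (a i)) IH) => x _; rewrite big_cons.
Qed.

Lemma bary_form_proof (k : nat) (a : 'I_n.+1 -> nat) (s : 'I_k -> 'I_n.+1) :
  (fun x u => (bary_pow a x)%:C * wedges (fun i => dbary (s i)) x u)
  \in @diff_form k.
Proof.
have [w0 wa ws] := formP (wedges (fun i => dbary (s i))).
apply/asboolP; split=> [x Tx u|x|u].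
- by rewrite w0// mulr0.
- have [wl wz] := wa x; split=> [i u b y z|u i j ij uij].
    by rewrite wl mulrDr mulrCA.
  by rewrite (wz _ _ _ ij)// mulr0.
- exact: csmoothM (csmooth_real (smooth_bary_pow a)) (ws u).
Qed.

(* lambda^a dlambda_s, with a : [0:n] -> N and s : [1:k] -> [0:n] indexed from 0 *)
Definition bary_form (k : nat) (a : 'I_n.+1 -> nat) (s : 'I_k -> 'I_n.+1) :
  form k := Form (bary_form_proof a s).

End Simplex.

Definition multi_index (r n : nat) : set ('I_n.+1 -> nat) :=
  [set a : 'I_n.+1 -> nat | (\sum_i a i)%N = r].

Definition increasing (k n : nat) : set ('I_k -> 'I_n.+1) :=
  [set s : 'I_k -> 'I_n.+1 | {homo s : i j / (i < j)%N}].

(* minimal element of the support of a; None stands for infinity *)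
Definition floor_index (n : nat) (a : 'I_n.+1 -> nat) : option 'I_n.+1 :=
  [pick i | (0 < a i)%N && [forall j, (0 < a j)%N ==> (i <= j)%N]].

Definition P_form (R : realType) (m n : nat) (T : simplex R m n) (r k : nat) :
    set (form T k) :=
  lin_span [set w | exists a s,
    [/\ multi_index r a, increasing s & w = bary_form T a s]].

Definition BP_form (R : realType) (m n : nat) (T : simplex R m n) (r k : nat) :
    set (form T k) :=
  [set w | exists a s,
    [/\ multi_index r a, increasing s,
        forall i, floor_index a <> Some (s i) & w = bary_form T a s]].

Arguments P_form {R m n} T r k.
Arguments BP_form {R m n} T r k.

(* Main.v *)
Require Import Defs.
From mathcomp Require Import all_boot all_order all_fingroup all_algebra.
From mathcomp Require Import complex.
From mathcomp Require Import all_classical all_reals all_analysis.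

(** Write det(s, u) for the determinant of the matrix of derivatives of the
    barycentric coordinates lambda_(s i) along tangent vectors u_j.  Unfolding
    the iterated wedge product by Laplace expansion along its first row shows
    that the form lambda^a dlambda_s takes the value lambda^a(x) det(s, u) at
    (x, u) ([bary_formE]), so every statement about forms becomes one about
    monomials and determinants.

    Spanning.  Suppose that the least index of the support of a is s p.  Since
    the lambda_j sum to 1, the dlambda_j sum to 0, and dlambda_(s p) may be
    replaced by minus the sum of all the other dlambda_j ([bary_form_swap]).
    In each resulting term the exponent a is unchanged and its least index has
    left the list s, so a single replacement suffices; it remains to sort the
    indices (a sign) or to discard a term with a repeated index
    ([lin_span_avoiding]).

    Linear independence.  Fix u in a vanishing linear combination.  The result
    is a homogeneous polynomial of degree r in the barycentric coordinates,
    zero on the simplex and hence, by homogeneity, at all points with positive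
    coordinates; so the coefficient of each monomial vanishes
    ([bary_pow_indep]).  This isolates the terms with a given exponent a.  All
    their index lists s avoid the same i0, the least index of a, and therefore
    the edge vectors from vertex i0 are dual to the dlambda_j that occur:
    choosing for u the edges to the vertices listed by s0 kills every term but
    the one of s0 ([det_edges]).  The condition on the least index is thus what
    selects, for each a, one vertex to be left out of all dlambda_s. *)

Set Implicit Arguments.
Unset Strict Implicit.
Unset Printing Implicit Defensive.

Import Order.TTheory GRing.Theory Num.Theory.

Local Open Scope classical_set_scope.
Local Open Scope ring_scope.
Local Open Scope complex_scope.

(** * Linear spans *)

Section Span.
Variables (K : fieldType) (E : lmodType K).
Implicit Types (B : set E) (w : E).

(** In [lin_span] the coefficient is a function of the vector, so a list in
    which a vector recurs with different coefficients has to be regrouped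
    before it shows membership. *)
Lemma lin_span_comb B (l : seq (K * E)) : (forall p, p \in l -> B p.2) ->
  lin_span B (\sum_(p <- l) p.1 *: p.2).
Proof.
move=> lB; exists (undup [seq p.2 | p <- l]).
exists (fun b => \sum_(p <- l | p.2 == b) p.1); split=> [b|].
  by rewrite mem_undup => /mapP[p /lB Bp ->].
under [RHS]eq_bigr do rewrite scaler_suml big_mkcond.
rewrite exchange_big/= big_seq [RHS]big_seq; apply: eq_bigr => p pl.
rewrite (bigD1_seq p.2) ?undup_uniq ?mem_undup ?map_f//= eqxx.
by rewrite big1 ?addr0// => b; rewrite eq_sym => /negPf->.
Qed.

Lemma lin_span_sum B (I : Type) (s : seq I) (c : I -> K) (w : I -> E) :
  (forall i, lin_span B (w i)) -> lin_span B (\sum_(i <- s) c i *: w i).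
Proof.
move=> Bw.
suff [l [lB ->]] : exists l : seq (K * E), (forall p, p \in l -> B p.2) /\
    \sum_(i <- s) c i *: w i = \sum_(p <- l) p.1 *: p.2.
  exact: lin_span_comb.
elim: s => [|i s [l [lB IH]]]; first by exists [::]; rewrite !big_nil.
have [t [d [tB wi]]] := Bw i.
exists ([seq (c i * d b, b) | b <- t] ++ l); split=> [p|].
  by rewrite mem_cat => /orP[/mapP[b /tB Bb ->]|/lB].
rewrite big_cons big_cat/= big_map IH; congr (_ + _).
by rewrite wi scaler_sumr; apply: eq_bigr => b _; rewrite scalerA.
Qed.

Lemma lin_spanZ B (c : K) w : lin_span B w -> lin_span B (c *: w).
Proof.
move=> Bw.
have := @lin_span_sum B _ [:: tt] (fun=> c) (fun=> w).
by rewrite big_seq1; apply.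
Qed.

Lemma lin_span0 B : lin_span B 0.
Proof. by exists [::], (fun=> 0); rewrite big_nil. Qed.

Lemma sub_lin_span B : B `<=` lin_span B.
Proof.
move=> b Bb; exists [:: b], (fun=> 1); rewrite big_seq1 scale1r.
by split=> // x; rewrite inE => /eqP->.
Qed.

Lemma lin_span_subset B B' : B' `<=` lin_span B -> lin_span B' `<=` lin_span B.
Proof.
move=> B'B _ [s [c [sB' ->]]].
rewrite big_seq big_mkcond/= (eq_bigr (fun b => c b *:
  (if b \in s then b else 0))) => [|b _]; last by case: ifP; rewrite ?scaler0.
apply: lin_span_sum => b; case: ifP => [/sB'/B'B//|_]; exact: lin_span0.
Qed.

End Span.

(** * Determinants *)

Section Determinants.
Variable A : comNzRingType.

(** The antisymmetrized product of a covector with a determinant of covectors,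
    as it occurs in the wedge product.  Expanding the minor over t in S_k and
    absorbing t into s gives the same full determinant for each t; this is the
    origin of the factor k!. *)
Lemma sum_perm_det_lift (k : nat) (M : 'M[A]_k.+1) :
  \sum_(s : 'S_k.+1) (-1) ^+ s *
    (M ord0 (s ord0) * \det (\matrix_(i, j) M (lift ord0 i) (s (lift ord0 j))))
  = k`!%:R * \det M.
Proof.
transitivity (\sum_(t : 'S_k) \sum_(s : 'S_k.+1) (-1) ^+ (t (+) s) *
    (M ord0 (s ord0) * \prod_i M (lift ord0 i) (s (lift ord0 (t i))))).
  rewrite exchange_big/=; apply: eq_bigr => s _.
  rewrite !mulr_sumr; apply: eq_bigr => t _.
  rewrite signr_addb (mulrCA (M _ _)) (mulrCA ((-1) ^+ s)) -[RHS]mulrA.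
  by congr (_ * (_ * (_ * _))); apply: eq_bigr => i _; rewrite mxE.
rewrite (eq_bigr (fun=> \det M)) => [|t _].
  by rewrite sumr_const card_Sn mulr_natl.
rewrite (reindex_inj (mulgI (lift_perm ord0 ord0 t)^-1%g)) /=.
apply: eq_bigr => s _.
rewrite odd_permM odd_permV odd_lift_perm addbb /= addKb big_ord_recl.
have lt0 : (lift_perm ord0 ord0 t)^-1%g ord0 = ord0.
  by apply/(canLR (permK _)); rewrite lift_perm_id.
have lti i : (lift_perm ord0 ord0 t)^-1%g (lift ord0 (t i)) = lift ord0 i.
  by apply/(canLR (permK _)); rewrite lift_perm_lift.
rewrite permM lt0; congr (_ * (_ * _)).
by apply: eq_bigr => i _; rewrite permM lti.
Qed.

Lemma det_row_perm (k : nat) (p : 'S_k) (M : 'M[A]_k) :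
  \det (row_perm p M) = (-1) ^+ p * \det M.
Proof. by rewrite row_permE det_mulmx det_perm. Qed.

(** Additivity of the determinant in row p: the sum is the determinant of a
    matrix whose row p is zero. *)
Lemma sum_det_row (k : nat) (I : finType) (p : 'I_k) (M : I -> 'M[A]_k) :
  (forall a b i j, i != p -> M a i j = M b i j) ->
  (forall j, \sum_a M a p j = 0) -> \sum_a \det (M a) = 0.
Proof.
move=> Mrow Mp.
have [a0|noI] := pickP (@predT I); last by rewrite big1// => a; have := noI a.
move=> _; rewrite (eq_bigr (fun a => \sum_j M a p j * cofactor (M a0) p j)).
  by rewrite exchange_big/= big1// => j _; rewrite -mulr_suml Mp mul0r.
move=> a _; rewrite (expand_det_row _ p); apply: eq_bigr => j _.
congr (_ * (_ * \det _)); apply/matrixP => i l; rewrite !mxE.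
by apply: Mrow; rewrite eq_sym neq_lift.
Qed.

End Determinants.

(** * Digits, polynomials and index lists *)

Lemma base_digits_inj (b n : nat) (a c : 'I_n -> nat) :
  (forall i, a i < b)%N -> (forall i, c i < b)%N ->
  (\sum_i a i * b ^ i = \sum_i c i * b ^ i)%N -> a =1 c.
Proof.
elim: n a c => [|n IH] a c ab cb; first by move=> _ [].
have b0 : (0 < b)%N by rewrite (leq_ltn_trans _ (ab ord0)).
rewrite !big_ord_recl !expn0 !muln1.
have step (d : 'I_n.+1 -> nat) : (\sum_(i < n) d (lift ord0 i) * b ^ lift ord0 i
    = (\sum_(i < n) d (lift ord0 i) * b ^ i) * b)%N.
  by rewrite big_distrl/=; apply: eq_bigr => i _; rewrite expnS mulnAC mulnA.
rewrite !step => e.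
have e0 : a ord0 = c ord0.
  have /= := congr1 (modn^~ b) e.
  by rewrite ![(_ + _ * b)%N]addnC !modnMDl !modn_small.
have tl : (fun i => a (lift ord0 i)) =1 (fun i => c (lift ord0 i)).
  apply: IH => [i|i|]; [exact: ab|exact: cb|].
  by move/eqP: e; rewrite e0 eqn_add2l eqn_pmul2r// => /eqP.
by move=> i; case: (unliftP ord0 i) => [j ->|->//]; exact: tl.
Qed.

Lemma poly_eq0_nat (F : numDomainType) (p : {poly F}) :
  (forall y : nat, p.[y.+1%:R] = 0) -> p = 0.
Proof.
move=> p0; apply/eqP/negPn/negP => pn0.
have := @max_poly_roots _ p [seq y.+1%:R | y <- iota 0 (size p)] pn0.
rewrite size_map size_iota ltnn => H; suff: false by []; apply: H.
  by apply/allP => _ /mapP[y _ ->]; apply/rootP.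
rewrite map_inj_uniq ?iota_uniq// => y z /eqP.
by rewrite eqr_nat eqSS => /eqP.
Qed.

Lemma exists_increasing (k n : nat) (s : 'I_k -> 'I_n.+1) : injective s ->
  exists p : 'S_k, @increasing k n (s \o p).
Proof.
move=> s_inj; pose t := [tuple s i | i < k].
pose st := sort (<=%O : rel 'I_n.+1) t.
have /tuple_permP[p pE] : perm_eq st t by rewrite perm_sort.
have st_sorted : sorted (<%O : rel 'I_n.+1) st.
  by rewrite sort_lt_sorted map_inj_uniq ?enum_uniq.
exists p => i j ij.
have sz : size st = k by rewrite size_sort size_tuple.
have stE (l : 'I_k) : nth ord0 st l = s (p l).
  rewrite pE (nth_map l) ?size_enum_ord// nth_ord_enum.
  by rewrite tnth_mktuple.
have := @lt_sorted_ltn_nth _ _ ord0 _ st_sorted i j.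
rewrite !inE sz !ltn_ord => /(_ isT isT).
by rewrite !stE ij.
Qed.

Lemma increasing_inj (k n : nat) (s : 'I_k -> 'I_n.+1) :
  increasing s -> injective s.
Proof.
move=> s_incr i j sij; apply/val_inj; case: (ltngtP i j) => // /s_incr;
by rewrite sij ltnn.
Qed.

(** An increasing list is the sorted enumeration of its image, and an inclusion
    between images of the same size is an equality. *)
Lemma increasing_subset (k n : nat) (s s' : 'I_k -> 'I_n.+1) :
  increasing s -> increasing s' ->
  (forall i, exists j, s i = s' j) -> s = s'.
Proof.
have srt (t : 'I_k -> 'I_n.+1) : increasing t ->
    sorted (<%O : rel 'I_n.+1) (map t (enum 'I_k)).
  move=> t_incr; have tlt : {homo t : i j / (i < j)%N >-> (i < j)%O} := t_incr.
  apply: (homo_sorted tlt).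
  rewrite -[sorted _ _]/(sorted (relpre val ltn) _) -sorted_map val_enum_ord.
  exact: iota_ltn_sorted.
move=> si s'i ss'.
have : map s (enum 'I_k) = map s' (enum 'I_k).
  apply: lt_sorted_eq; [exact: srt|exact: srt|].
  apply: (uniq_min_size _ _ _).2; last by rewrite !size_map.
    by rewrite map_inj_uniq ?enum_uniq//; exact: increasing_inj.
  by move=> _ /mapP[i _ ->]; have [j ->] := ss' i; rewrite map_f ?mem_enum.
by move=> /eq_in_map e; apply/funext => i; apply: e; rewrite mem_enum.
Qed.

Lemma floor_index_some (n r : nat) (a : 'I_n.+1 -> nat) :
  (0 < r)%N -> multi_index r a ->
  exists i, floor_index a = Some i.
Proof.
rewrite /multi_index/= => r0 ar.
have [i ai] : exists i, (0 < a i)%N.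
  apply: contrapT => /forallNP a0; move: r0; rewrite -ar big1// => i _.
  by apply/eqP; rewrite -leqn0 leqNgt; exact/negP.
rewrite /floor_index; case: pickP => [j _|]; first by exists j.
have [j aj jmin] := @arg_minnP _ i (fun i => 0 < a i)%N val ai.
move=> /(_ j); rewrite aj => /negP[]; apply/forallP => l.
by apply/implyP; exact: jmin.
Qed.

Lemma sum_ord_gt0 (R : numDomainType) (n : nat) (t : 'I_n.+1 -> R) :
  (forall i, 0 < t i) -> 0 < \sum_i t i.
Proof.
move=> t0; rewrite big_ord_recl ltr_pwDl// sumr_ge0// => i _; exact: ltW.
Qed.

(** * Pointwise values of the forms *)

Section Forms.
Variables (R : realType) (m n : nat) (T : simplex R m n).
Local Notation TV := (subvs_of (tangent T)).

(** The matrix of the covectors dlambda_(s i) on the vectors u_j; it does not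
    depend on the point, as barycentric coordinates are affine. *)
Definition bary_mx (k : nat) (s : 'I_k -> 'I_n.+1) (u : 'I_k -> TV) : 'M[R]_k :=
  \matrix_(i, j) bary_lin T (s i) (vsval (u j)).

Lemma sum_bary_lin (u : TV) : \sum_i bary_lin T i (vsval u) = 0.
Proof.
have [c [c0 ->]] := tangentP u.
by rewrite -[RHS]c0; apply: eq_bigr => i _; rewrite bary_linE.
Qed.

(** Induction on k: the last k factors contribute a k x k determinant, and
    [sum_perm_det_lift] cancels the normalization 1 / (1! k!) of the wedge. *)
Lemma wedges_det (k : nat) (s : 'I_k -> 'I_n.+1) x (u : 'I_k -> TV) :
  spx T x -> wedges (fun i => dbary T (s i)) x u = (\det (bary_mx s u))%:C.
Proof.
move=> Tx; elim: k s u => [|k IH] s u.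
  by rewrite /= mem_set// det_mx00.
have sumE := sum_perm_det_lift (bary_mx s u).
have k0 : (k`!%:R : R[i]) != 0 by rewrite pnatr_eq0 -lt0n fact_gt0.
apply: (mulfI k0).
rewrite -[in RHS](rmorph_nat (real_complex R)) -rmorphM -sumE /= mul1n.
rewrite mulrA mulfV// mul1r rmorph_sum/=; apply: eq_bigr => t _.
rewrite rmorphM rmorphXn rmorphN1 rmorphM/=; congr (_ * (_ * _)).
  rewrite mem_set// mxE; have [_ ->] := is_derive_bary (s ord0)
     (u (t (lshift k ord0))) (spx_sub_aff Tx).
  by congr (bary_lin _ _ (vsval (u (t _))))%:C; exact/val_inj.
rewrite IH; congr (\det _)%:C; apply/matrixP => i j; rewrite !mxE.
by congr (bary_lin _ _ (vsval (u (t _)))); exact/val_inj.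
Qed.

Lemma bary_formE (k : nat) a (s : 'I_k -> 'I_n.+1) x (u : 'I_k -> TV) :
  spx T x ->
  bary_form T a s x u = (bary_pow T a x)%:C * (\det (bary_mx s u))%:C.
Proof. by move=> Tx; rewrite /bary_form/= wedges_det. Qed.

Lemma form_ext (k : nat) (w e : Defs.form T k) :
  (forall x u, spx T x -> w x u = e x u) -> w = e.
Proof.
move=> we; apply/val_inj/funext => x; apply/funext => u /=.
have [Tx|Tx] := pselect (spx T x); first exact: we.
by have [w0 _ _] := formP w; have [e0 _ _] := formP e; rewrite w0 ?e0.
Qed.

Lemma form_sumE (k : nat) (I : Type) (l : seq I) (c : I -> R[i])
    (w : I -> Defs.form T k) x (u : 'I_k -> TV) :
  (\sum_(i <- l) c i *: w i : Defs.form T k) x u = \sum_(i <- l) c i * w i x u.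
Proof. by elim: l => [|i l IH]; rewrite ?big_nil// !big_cons -IH. Qed.

Lemma form_scaleE (k : nat) (c : R[i]) (w : Defs.form T k) x (u : 'I_k -> TV) :
  (c *: w) x u = c * w x u.
Proof. by []. Qed.

(** * Spanning *)

Lemma bary_form_not_inj (k : nat) a (s : 'I_k -> 'I_n.+1) :
  ~ injective s -> bary_form T a s = 0.
Proof.
move=> /injectiveP/injectivePn[i [j ij sij]]; apply: form_ext => x u Tx.
rewrite bary_formE// (determinant_alternate ij) ?mulr0// => l.
by rewrite !mxE sij.
Qed.

Lemma bary_form_perm (k : nat) a (s : 'I_k -> 'I_n.+1) (p : 'S_k) :
  bary_form T a (s \o p) = (-1) ^+ p *: bary_form T a s.
Proof.
apply: form_ext => x u Tx; rewrite form_scaleE !bary_formE// mulrCA.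
congr (_ * _); rewrite (_ : bary_mx _ _ = row_perm p (bary_mx s u)); last first.
  by apply/matrixP => i j; rewrite !mxE.
by rewrite det_row_perm rmorphM rmorphXn rmorphN1.
Qed.

Definition set_index (k : nat) (s : 'I_k -> 'I_n.+1) p j : 'I_k -> 'I_n.+1 :=
  fun i => if i == p then j else s i.

(** This is dlambda_(s p) = - sum of the other dlambda_j, inserted in slot p.
    All j <> s p are kept in the sum: those already in the list s give zero
    forms. *)
Lemma bary_form_swap (k : nat) a (s : 'I_k -> 'I_n.+1) (p : 'I_k) :
  bary_form T a s =
  \sum_(j <- index_enum 'I_n.+1) (if j == s p then 0 else -1) *:
    bary_form T a (set_index s p j).
Proof.
apply: form_ext => x u Tx.
rewrite form_sumE (bigD1 (s p))//= eqxx mul0r add0r.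
have sE : set_index s p (s p) = s.
  by apply/funext => i; rewrite /set_index; case: eqP => // ->.
have : \sum_j bary_form T a (set_index s p j) x u = 0.
  under eq_bigr do rewrite bary_formE//.
  rewrite -mulr_sumr -rmorph_sum/= (@sum_det_row _ _ _ p) ?mulr0//
    => [b c i j ip|j].
    by rewrite !mxE /set_index (negPf ip).
  rewrite -[RHS](sum_bary_lin (u j)); apply: eq_bigr => i _.
  by rewrite mxE /set_index eqxx.
rewrite (bigD1 (s p))//= sE => /eqP; rewrite addr_eq0 => /eqP->.
by rewrite -sumrN; apply: eq_bigr => j /negPf->; rewrite mulN1r.
Qed.

(** Neither sorting the indices nor repeating one brings back the least index
    of a, so here s may be arbitrary. *)
Lemma lin_span_avoiding r k a (s : 'I_k -> 'I_n.+1) : multi_index r a ->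
  (forall i, floor_index a <> Some (s i)) ->
  lin_span (BP_form T r k) (bary_form T a s).
Proof.
move=> ar sa.
have [s_inj|/bary_form_not_inj->] := pselect (injective s); last first.
  exact: lin_span0.
have [p sp] := exists_increasing s_inj.
have -> : bary_form T a s = (-1) ^+ p *: bary_form T a (s \o p).
  by rewrite bary_form_perm scalerA -signr_addb addbb scale1r.
apply/lin_spanZ/sub_lin_span; exists a, (s \o p); split=> // i; exact: sa.
Qed.

Lemma lin_span_injective r k a (s : 'I_k -> 'I_n.+1) : multi_index r a ->
  injective s -> lin_span (BP_form T r k) (bary_form T a s).
Proof.
move=> ar s_inj.
have [sa|] := pselect (forall i, floor_index a <> Some (s i)).
  exact: lin_span_avoiding.
move=> /existsNP[p /contrapT ap]; rewrite (bary_form_swap a s p).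
rewrite (eq_bigr (fun j => (-1) *: (if j == s p then 0
  else bary_form T a (set_index s p j)))) => [|j _]; last first.
  by case: ifP; rewrite ?scaler0 ?scale0r.
apply: lin_span_sum => j; case: eqP => [_|jsp]; first exact: lin_span0.
apply: lin_span_avoiding => // i; rewrite ap /set_index.
case: eqP => [_ [/esym//]|ip [/s_inj/esym//]].
Qed.

(** * Linear independence *)

(** Homogeneity: any point of the positive orthant is S times the barycentric
    coordinate vector of a point of the simplex. *)
Lemma bary_pow_scaled r a (t : 'I_n.+1 -> R) : multi_index r a ->
  (forall i, 0 < t i) -> let S := \sum_i t i in
  bary_pow T a (\sum_j (t j / S) *: T j) = (S ^+ r)^-1 * \prod_i t i ^+ a i.
Proof.
move=> ar t0 S.
have S0 : 0 < S by exact: sum_ord_gt0.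
have tS : \sum_j t j / S = 1 by rewrite -mulr_suml mulfV ?gt_eqF.
rewrite /bary_pow (eq_bigr (fun i => (S ^- a i) * t i ^+ a i)) => [|i _].
  by rewrite big_split/= prodfV prodrXr ar.
by rewrite baryE// exprMn exprVn mulrC.
Qed.

Lemma spx_scaled (t : 'I_n.+1 -> R) : (forall i, 0 < t i) ->
  spx T (\sum_j (t j / \sum_i t i) *: T j).
Proof.
move=> t0; have S0 := sum_ord_gt0 t0.
exists (fun j => t j / \sum_i t i); split=> // [j|].
  by rewrite ltW// divr_gt0.
by rewrite -mulr_suml mulfV ?gt_eqF.
Qed.

(** Monomials of degree r in the barycentric coordinates are linearly
    independent, by Kronecker's substitution t_i = y ^ ((r + 1) ^ i).  It turns
    the monomial with exponent b into y ^ (N b), where N b has the digits b in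
    base r + 1; these digits are at most r, so distinct monomials become
    distinct powers of y, and one-variable polynomials can be used. *)
Lemma bary_pow_indep r (I : eqType) (l : seq I) (d : I -> R[i])
    (a : I -> 'I_n.+1 -> nat) (a0 : 'I_n.+1 -> nat) :
  (forall i, i \in l -> multi_index r (a i)) -> multi_index r a0 ->
  (forall x, spx T x -> \sum_(i <- l) d i * (bary_pow T (a i) x)%:C = 0) ->
  \sum_(i <- l | `[< a i = a0 >]) d i = 0.
Proof.
move=> al a0r d0.
pose N (b : 'I_n.+1 -> nat) := (\sum_i b i * r.+1 ^ i)%N.
have digit b i : multi_index r b -> (b i < r.+1)%N.
  by rewrite /multi_index/= => <-; rewrite ltnS (bigD1 i)//= leq_addr.
pose P : {poly R[i]} := \sum_(i <- l) d i *: 'X^(N (a i)).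
have P0 : P = 0.
  apply: poly_eq0_nat => y.
  pose t (i : 'I_n.+1) : R := y.+1%:R ^+ (r.+1 ^ i).
  have t0 i : 0 < t i by rewrite exprn_gt0// ltr0n.
  pose S := \sum_i t i.
  have S0 : 0 < S by exact: sum_ord_gt0.
  have Sr : ((S ^+ r)^-1)%:C != 0.
    by rewrite fmorph_eq0 invr_eq0 expf_neq0// gt_eqF.
  apply: (mulfI Sr); rewrite mulr0 -[RHS](d0 _ (spx_scaled t0)).
  rewrite horner_sum mulr_sumr; apply: eq_big_seq => i il /=.
  rewrite hornerZ hornerXn (bary_pow_scaled (al _ il))// mulrCA.
  rewrite rmorphM/=; congr (_ * (_ * _)).
  have -> : \prod_j t j ^+ a i j = y.+1%:R ^+ N (a i).
    rewrite -prodrXr; apply: eq_bigr => j _.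
    by rewrite -exprM mulnC.
  by rewrite rmorphXn rmorph_nat.
rewrite -[RHS](coef0 R[i] (N a0)) -P0 coef_sum big_mkcond.
apply: eq_big_seq => i il /=.
rewrite coefZ coefXn; case: asboolP => [->|aa]; first by rewrite eqxx mulr1.
case: eqP => [Na|_]; last by rewrite mulr0.
case: aa; apply/funext/(base_digits_inj _ _ (esym Na)) => j; apply: digit => //.
exact: al.
Qed.

Lemma bary_lin_edge i j l :
  bary_lin T i (T j - T l) = (i == j)%:R - (i == l)%:R.
Proof.
pose e (j i : 'I_n.+1) : R := (i == j)%:R.
have eT q : \sum_i e q i *: T i = T q.
  rewrite (bigD1 q)//= /e eqxx scale1r big1 ?addr0// => p /negPf->.
  by rewrite scale0r.
have e1 q : \sum_i e q i = 1.
  by rewrite (bigD1 q)//= /e eqxx big1 ?addr0// => p /negPf->.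
rewrite -[in LHS](eT j) -[in LHS](eT l) -sumrB.
under eq_bigr do rewrite -scalerBl.
by rewrite bary_linE// sumrB !e1 subrr.
Qed.

(** The edges of the simplex from vertex i0 to the vertices listed by s; the
    projection only casts them to the type of tangent vectors. *)
Definition edges (k : nat) i0 (s : 'I_k -> 'I_n.+1) : 'I_k -> TV :=
  fun j => vsproj (tangent T) (T (s j) - T i0).

Lemma edge_tangent j l : T j - T l \in tangent T.
Proof.
have tg q : T q - T ord0 \in tangent T.
  by rewrite memv_span// (fintype.image_f (fun j => T j - T ord0)).
by rewrite -(subrKA (T ord0)) -[T ord0 - _]opprB rpredB.
Qed.

(** Away from i0 the matrix has entries delta_(s i, s' j).  It is the identity
    when s = s', and otherwise some s p is not listed by s', which gives a zero
    row. *)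
Lemma det_edges k i0 (s s' : 'I_k -> 'I_n.+1) : increasing s -> increasing s' ->
  (forall i, s i != i0) -> \det (bary_mx s (edges i0 s')) = `[< s = s' >]%:R.
Proof.
move=> si s'i si0.
have mxE' i j : bary_mx s (edges i0 s') i j = (s i == s' j)%:R.
  rewrite mxE vsprojK ?edge_tangent// bary_lin_edge.
  by rewrite (negPf (si0 i)) subr0.
case: asboolP => [ss'|ss'].
  rewrite (_ : bary_mx _ _ = 1%:M) ?det1//; apply/matrixP => i j.
  by rewrite mxE' mxE -ss' (inj_eq (increasing_inj si)).
have [p sp] : exists p, forall j, s p != s' j.
  apply: contrapT => /forallNP H; apply/ss'/increasing_subset => // i.
  by have /existsNP[j /negP] := H i; rewrite negbK => /eqP ?; exists j.
rewrite (expand_det_row _ p) big1// => j _.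
by rewrite mxE' (negPf (sp j)) mul0r.
Qed.

Lemma BP_form_indep r k : (0 < r)%N -> lin_indep (BP_form T r k).
Proof.
move=> r0 s c s_uniq sB sum0 b0 b0s.
(* Exponents and index lists are chosen as functions of the form, so distinct
   vectors of the list s carry distinct pairs. *)
have : forall b : Defs.form T k,
    exists p : ('I_n.+1 -> nat) * ('I_k -> 'I_n.+1),
    b \in s -> [/\ multi_index r p.1, increasing p.2,
      forall i, floor_index p.1 <> Some (p.2 i) & b = bary_form T p.1 p.2].
  move=> b; have [bs|_] := boolP (b \in s).
    by have [a [t H]] := sB _ bs; exists (a, t).
  by exists (fun=> 0%N, fun=> ord0).
move=> /choice[f fP].
have [a0r s0_incr s0_floor b0E] := fP _ b0s.
have [i0 ai0] := floor_index_some r0 a0r.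
have avoid b i : b \in s -> (f b).1 = (f b0).1 -> (f b).2 i != i0.
  move=> /fP[_ _ bf _] bb0; apply/eqP => bi; apply: (bf i).
  by rewrite bb0 bi.
pose u := edges i0 (f b0).2.
have : \sum_(b <- s | `[< (f b).1 = (f b0).1 >])
    c b * (\det (bary_mx (f b).2 u))%:C = 0.
  apply: (bary_pow_indep (r := r)) => // [b /fP[]//|x Tx].
  transitivity (\sum_(b <- s) c b * b x u).
    apply: eq_big_seq => b bs /=; have [_ _ _ bE] := fP b bs.
    by rewrite -mulrA [_%:C * _]mulrC -bary_formE// -bE.
  by have /= := form_sumE s c id x u; rewrite sum0 => <-.
rewrite big_mkcond/= (bigD1_seq b0)//= asboolT// big1_seq ?addr0 => [|b].
  rewrite det_edges// => [|i]; last exact: avoid.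
  by rewrite asboolT// mulr1.
move=> /andP[bb0 bs]; case: asboolP => // ab.
have [_ b_incr _ bE] := fP _ bs.
rewrite det_edges// => [|i]; last exact: avoid.
rewrite asboolF ?mulr0// => sb; move/eqP: bb0; apply.
by rewrite bE b0E ab sb.
Qed.

End Forms.

Theorem theorem4p1 (R : realType) (m n : nat) (T : simplex R m n) (k r : nat)
  (hk : (k <= n)%N) (hr : (1 <= r)%N) :
  is_basis (BP_form T r k) (P_form T r k).
Proof.
split; first exact: BP_form_indep.
apply/seteqP; split; apply: lin_span_subset.
  move=> _ [a [s [ar s_incr _ ->]]].
  by apply: sub_lin_span; exists a, s.
move=> _ [a [s [ar s_incr ->]]].
by apply: lin_span_injective => //; exact: increasing_inj s_incr.
Qed.
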